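(* Let $S\subseteq\mathbb{R}^n$ be a compact set. Then the following are equivalent: (a) $S$ is rational MICP-R. (b) $S$ is a finite union of compact convex sets. (c) $S$ is pure binary MICP-R. (d) $S$ is binary MICP-R.
   Context: $\mathbb{N}=\{1,2,\dots\}$, $\mathbb{Z}_+=\{0,1,2,\dots\}$; $n\in\mathbb{N}$, $p,d\in\mathbb{Z}_+$. A closed convex set $M\subseteq\mathbb{R}^{n+p+d}$ (with $d$) induces an MICP formulation of $S\subseteq\mathbb{R}^n$ if for every $x\in\mathbb{R}^n$: $x\in S$ iff there exist $y\in\mathbb{R}^p$, $z\in\mathbb{Z}^d$ with $(x,y,z)\in M$. The formulation is pure if $p=0$. The set $S$ is binary MICP-R if it has an MICP formulation induced by a closed convex $M$ with $\operatorname{proj}_z(M\cap(\mathbb{R}^{n+p}\times\mathbb{Z}^d))\subseteq\{0,1\}^d$, where $\operatorname{proj}_z$ is projection onto the last $d$ coordinates; it is pure binary MICP-R if this can be done with $p=0$. The index set of the formulation induced by $M$ is $I=\operatorname{proj}_z(M)\subseteq\mathbb{R}^d$. For a convex (not necessarily closed) set $C\subseteq\mathbb{R}^d$, its recession cone is $C_\infty=\{r\in\mathbb{R}^d : x+\lambda r\in C\ \ \forall x\in C,\ \lambda\ge 0\}$. A convex set $I\subseteq\mathbb{R}^d$ is rationally unbounded if for every image $I'\subseteq\mathbb{R}^{d'}$ of $I$ under a rational affine map (a map $z\mapsto Az+b$ with $A,b$ having rational entries), either $I'$ is bounded or $\mathbb{Z}^{d'}\cap(I'_\infty\setminus\{0\})\neq\emptyset$.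 The set $S$ is rational MICP-R if it has an MICP formulation induced by some closed convex $M$ whose index set is rationally unbounded. *)

(* Defs.v *)
From HB Require Import structures.
From mathcomp Require Import all_boot all_order all_algebra.
From mathcomp Require Import all_classical all_reals all_analysis.
Set Implicit Arguments.
Unset Strict Implicit.
Unset Printing Implicit Defensive.
Import Order.TTheory GRing.Theory Num.Theory.
Import numFieldNormedType.Exports.
Local Open Scope classical_set_scope.
Local Open Scope ring_scope.

(* Vectors of R^m are row vectors 'rV[R]_m; a point (x, y, z) of R^(n+p+d) is
   row_mx (row_mx x y) z. *)

Definition integral_points (R : realType) (d : nat) : set 'rV[R]_d :=
  [set z | z \is a mxOver Num.int].

Definition binary_points (R : realType) (d : nat) : set 'rV[R]_d :=
  [set z | forall j, z 0 j = 0 \/ z 0 j = 1].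

Definition proj_z (R : realType) (m d : nat) (M : set 'rV[R]_(m + d)) :
    set 'rV[R]_d :=
  rsubmx @` M.

Definition induces_MICP (R : realType) (n p d : nat)
    (M : set 'rV[R]_(n + p + d)) (S : set 'rV[R]_n) : Prop :=
  [/\ closed M, convex_set M &
    forall x : 'rV[R]_n, S x <->
      exists (y : 'rV[R]_p) (z : 'rV[R]_d),
        integral_points z /\ M (row_mx (row_mx x y) z)].

Definition binary_formulation (R : realType) (n p d : nat)
    (M : set 'rV[R]_(n + p + d)) (S : set 'rV[R]_n) : Prop :=
  induces_MICP M S /\
  proj_z (M `&` [set v | integral_points (rsubmx v)]) `<=` @binary_points R d.

Definition binary_MICPR (R : realType) (n : nat) (S : set 'rV[R]_n) : Prop :=
  exists (p d : nat) (M : set 'rV[R]_(n + p + d)), binary_formulation M S.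

Definition pure_binary_MICPR (R : realType) (n : nat) (S : set 'rV[R]_n) :
    Prop :=
  exists (d : nat) (M : set 'rV[R]_(n + 0 + d)), binary_formulation M S.

Definition recession_cone (R : realType) (d : nat) (C : set 'rV[R]_d) :
    set 'rV[R]_d :=
  [set r | forall (x : 'rV[R]_d) (l : R), C x -> 0 <= l -> C (x + l *: r)].

(* With row vectors, the matrix A below is the transpose of the matrix of
   the affine map. *)
Definition rational_affine (R : realType) (d d' : nat)
    (A : 'M[rat]_(d, d')) (b : 'rV[rat]_d') (z : 'rV[R]_d) : 'rV[R]_d' :=
  z *m map_mx ratr A + map_mx ratr b.

Definition rationally_unbounded (R : realType) (d : nat)
    (I : set 'rV[R]_d) : Prop :=
  forall (d' : nat) (A : 'M[rat]_(d, d')) (b : 'rV[rat]_d'),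
    let I' := rational_affine A b @` I in
    bounded_set I' \/
    @integral_points R d' `&` (recession_cone I' `\ 0) !=set0.

Definition rational_MICPR (R : realType) (n : nat) (S : set 'rV[R]_n) : Prop :=
  exists (p d : nat) (M : set 'rV[R]_(n + p + d)),
    induces_MICP M S /\ rationally_unbounded (proj_z M).

Definition finite_union_compact_convex (R : realType) (n : nat)
    (S : set 'rV[R]_n) : Prop :=
  exists (k : nat) (C : 'I_k -> set 'rV[R]_n),
    (forall i, compact (C i) /\ convex_set (C i)) /\ S = \bigcup_i C i.

(* Main.v *)
Require Import Defs.
From mathcomp Require Import all_boot all_order all_algebra.
From mathcomp Require Import all_classical all_reals all_analysis.
From mathcomp Require Import zify lra.
Import Order.TTheory GRing.Theory Num.Theory.
Import numFieldNormedType.Exports.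

(** A formulation writes [S] as the union, over integral [z], of the convex sets
    of those [x] for which some (x, y, z) is in [M]. When finitely many [z]
    suffice, in particular for a binary formulation, the closures of these sets
    are compact convex subsets of [S], and their union is [S]
    ([finite_union_compact_convex_closure]).

    A rational formulation may use infinitely many [z], but then its index set
    is unbounded, so it has a nonzero integral recession direction r. The set [M] contains points
    over z + s r for all s >= 0, and for integral s their x-parts lie in the
    bounded set [S]. Combining a point over z with such points for large s moves
    x arbitrarily little, so the piece over z is in the closure of the piece over
    z + r ([fiber_sub_closure_shift]). The pieces over a whole line in direction
    r, at real positions as well, thus lie in [S], and [S] is still the union of
    the pieces obtained when the integer variables are only known modulo r. The
    image of the index set modulo r is again subject to the dichotomy of rational
    unboundedness, so the argument repeats until that image is bounded; the rank
    of the rational projection drops each time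
    ([finite_union_of_lattice_fibers]).

    Conversely, if [S] is the union of the compact convex sets C_1, ..., C_k,
    then the convex hull of the sets C_i x {e_i} is a compact convex set. Its
    integral weights are the unit vectors e_i, so it induces a pure binary
    formulation of [S] ([cayley_hull_formulation]). Compactness also makes the
    index set bounded, hence rationally unbounded. *)

Set Implicit Arguments.
Unset Strict Implicit.
Unset Printing Implicit Defensive.
Local Open Scope classical_set_scope.
Local Open Scope ring_scope.

(** * Convexity and continuity in spaces of row vectors *)

(** Membership with explicit real weights, which avoids carrying weights of the
    interval type [{i01 R}] through computations. *)
Lemma convex_setP (R : realType) (V : lmodType R) (A : set V) :
  convex_set A <->
  forall (x y : V) (t : R), 0 <= t -> t <= 1 -> A x -> A y ->
    A (t *: x + (1 - t) *: y).
Proof.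
split=> [Aconv x y t t0 t1 Ax Ay | Aconv x y t /set_mem Ax /set_mem Ay].
  by apply/set_mem; apply: (Aconv x y (Itv01 t0 t1)); exact: mem_set.
by apply/mem_set/Aconv.
Qed.

(** The map (u, v) |-> t u + (1 - t) v is continuous, so points of [A] close to
    [x] and [y] have a combination close to that of [x] and [y]. *)
Lemma convex_closure (R : realType) (n : nat) (A : set 'rV[R]_n) :
  convex_set A -> convex_set (closure A).
Proof.
move=> /convex_setP Aconv; apply/convex_setP => x y t t0 t1 Ax Ay B.
have cont : {for (x, y), continuous
    (fun uv : 'rV[R]_n * 'rV[R]_n => t *: uv.1 + (1 - t) *: uv.2)}.
  by apply: cvgD; apply: cvgZr; [exact: cvg_fst | exact: cvg_snd].
move=> /cont [[P Q] /= [Px Qy] PQB].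
have [u [Au Pu]] := Ax _ Px; have [v [Av Qv]] := Ay _ Qy.
by exists (t *: u + (1 - t) *: v); split; [exact: Aconv | exact: (PQB (u, v))].
Qed.

Lemma mx_continuous (R : realType) (T : topologicalType) (m n : nat)
    (f : T -> 'M[R]_(m, n)) :
  (forall i j, continuous (fun t => f t i j)) -> continuous f.
Proof.
move=> fcont t B /nbhs_ballP [e /= e0 eB].
suff : \forall s \near t, forall i j, ball (f t i j) e (f s i j).
  by apply: filterS => s fs; apply: eB; split.
apply: filter_forall => i; apply: filter_forall => j.
exact: (fcont i j t _ (nbhsx_ballx _ _ e0)).
Qed.

Lemma entry_continuous (R : realType) (T : topologicalType) (m n : nat)
    (f : T -> 'M[R]_(m, n)) i j :
  continuous f -> continuous (fun t => f t i j).
Proof.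
move=> fcont t; apply: (continuous_comp (g := fun M : 'M[R]_(_, _) => M i j)).
  exact: fcont.
exact: coord_continuous.
Qed.

Lemma mulmx_continuous (R : realType) (T : topologicalType) (m n p : nat)
    (f : T -> 'M[R]_(m, n)) (g : T -> 'M[R]_(n, p)) :
  continuous f -> continuous g -> continuous (fun t => f t *m g t).
Proof.
move=> fcont gcont; apply: mx_continuous => i k.
rewrite (_ : (fun t => _) = fun t => \sum_j f t i j * g t j k); last first.
  by apply/funext => t; rewrite mxE.
apply: continuous_big => [|j _ t]; first exact: add_continuous.
by apply: cvgM; exact: entry_continuous.
Qed.

Lemma row_mx_continuous (R : realType) (T : topologicalType) (m n p : nat)
    (f : T -> 'M[R]_(m, n)) (g : T -> 'M[R]_(m, p)) :
  continuous f -> continuous g -> continuous (fun t => row_mx (f t) (g t)).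
Proof.
move=> fcont gcont; apply: mx_continuous => i j; case: (split_ordP j) => l ->.
  by under eq_fun do rewrite row_mxEl; exact: entry_continuous.
by under eq_fun do rewrite row_mxEr; exact: entry_continuous.
Qed.

(** Pieces of a formulation are projections of closed sets and need not be
    closed. Since [S] is closed, replacing each piece by its closure adds no
    point to the union. *)
Lemma finite_union_compact_convex_closure (R : realType) (n : nat)
    (J : eqType) (F : set J) (T : J -> set 'rV[R]_n) (S : set 'rV[R]_n) :
  compact S -> finite_set F -> (forall j, convex_set (T j)) ->
  S = \bigcup_(j in F) T j -> finite_union_compact_convex S.
Proof.
move=> Scompact /finite_seqP[s ->{F}] Tconv SE.
have Sclosed : closed S by apply: compact_closed => //; exact: norm_hausdorff.
exists (size s), (fun i : 'I_(size s) => closure (T (tnth (in_tuple s) i))).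
have TS i : closure (T (tnth (in_tuple s) i)) `<=` S.
  apply: subset_trans Sclosed; apply: closureS; rewrite {1}SE.
  by apply: bigcup_sup => /=; exact: mem_tnth.
split=> [i|].
  split; last exact: convex_closure.
  by apply: (subclosed_compact _ Scompact) (TS i); exact: closed_closure.
apply/seteqP; split=> [x | x [i _]]; last exact: TS.
rewrite {1}SE => -[j /= js Tx].
have /tnthP[i ji] : j \in in_tuple s by [].
by exists i => //; apply: subset_closure; rewrite -ji.
Qed.

(** * Integral and rational points *)

(** Shifting by an integer bound [K] of the entries encodes such a point by a
    row of elements of a finite ordinal type. *)
Lemma finite_bounded_integral_points (R : realType) (d : nat) (B : R) :
  finite_set (@integral_points R d `&` [set z | forall j, `|z 0 j| <= B]).
Proof.
pose K := Num.bound B.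
pose of_code (v : 'rV['I_(K.*2.+1)]_d) : 'rV[R]_d :=
  \row_j ((v 0 j)%:R - K%:R).
apply: (sub_finite_set (B := of_code @` [set: _])); last first.
  by apply: finite_image; exact: finite_finset.
move=> z [/mxOverP zint zB].
have code j : exists c : 'I_(K.*2.+1), z 0 j = (c : nat)%:R - K%:R.
  have /intrP[k zk] := zint 0 j.
  have : `|k|%:~R <= K%:R :> R.
    rewrite intr_norm -zk (le_trans (zB j))// ltW// archi_boundP//.
    exact: le_trans (zB j).
  rewrite pmulrn ler_int => kK.
  have cK : (`|(k + K%:Z)%R|%N < K.*2.+1)%N by lia.
  exists (Ordinal cK); rewrite zk /= !pmulrn -intrB.
  by congr (_%:~R); lia.
exists (\row_j sval (cid (code j))) => //; apply/rowP => j.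
by rewrite /of_code !mxE; case: (cid (code j)).
Qed.

Lemma mx_common_denominator (m n : nat) (A : 'M[rat]_(m, n)) :
  exists2 N : nat, (0 < N)%N & N%:R *: A \is a mxOver Num.int.
Proof.
pose N := \prod_(p : 'I_m * 'I_n) `|denq (A p.1 p.2)|%N.
exists N; first by apply: prodn_gt0 => p; rewrite absz_gt0 denq_neq0.
apply/mxOverP => i j; rewrite mxE /N (bigD1 (i, j)) //= natrM mulrAC.
rewrite [_ %:R * A i j](_ : _ = (numq (A i j))%:~R); last first.
  by rewrite numqE mulrC pmulrn absz_denq.
by rewrite rpredM // ?natr_int ?intr_int.
Qed.

Lemma integral_ratr (R : realType) (m n : nat) (A : 'M[rat]_(m, n)) :
  A \is a mxOver Num.int -> map_mx ratr A \is a @mxOver _ _ R Num.int.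
Proof.
move=> /mxOverP Aint; apply/mxOverP => i j; rewrite mxE.
by have /intrP[k ->] := Aint i j; rewrite ratr_int intr_int.
Qed.

Lemma integral_is_ratr (R : realType) (m n : nat) (w : 'M[R]_(m, n)) :
  w \is a mxOver Num.int -> exists q : 'M[rat]_(m, n), w = map_mx ratr q.
Proof.
move=> /mxOverP wint; exists (\matrix_(i, j) (Num.floor (w i j))%:~R).
by apply/matrixP => i j; rewrite !mxE ratr_int floorK.
Qed.

(** Up to a common denominator of [A], the points [z *m A] are integral, so only
    finitely many of them lie in a bounded set. *)
Lemma finite_bounded_rational_lattice (R : realType) (d e : nat)
    (A : 'M[rat]_(d, e)) (D : set 'rV[R]_e) :
  bounded_set D ->
  finite_set ([set z *m map_mx ratr A | z in @integral_points R d] `&` D).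
Proof.
set AR := map_mx ratr A => /ex_strict_bound_gt0[B B0 DB].
have [N N0 NA] := mx_common_denominator A.
have NR0 : (0 : R) < N%:R by rewrite ltr0n.
apply: (sub_finite_set (B := *:%R N%:R^-1 @`
    (@integral_points R e `&` [set u | forall j, `|u 0 j| <= N%:R * B]))).
  move=> _ [[z zint <-] Dz]; exists (N%:R *: (z *m AR)); last first.
    by rewrite scalerA mulVf ?gt_eqF// scale1r.
  split.
    rewrite /integral_points /= scalemxAr.
    have -> : N%:R *: AR = map_mx ratr (N%:R *: A).
      by rewrite map_mxZ rmorph_nat.
    by apply: mxOverM => //; exact: integral_ratr.
  move=> j; rewrite mxE normrM gtr0_norm// ler_pM2l//.
  (* Balls of matrices are products of balls of the entries. *)
  have : ball 0 B (z *m AR) by rewrite -ball_normE /= sub0r normrN DB.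
  by move=> [_ /(_ 0 j)]; rewrite -ball_normE /= mxE sub0r normrN => /ltW.
by apply: finite_image; exact: finite_bounded_integral_points.
Qed.

(** Projecting along [r] kills the line of [r], which lies in the row space of
    [A]. *)
Lemma mxrank_mul_cokermx_lt (F : fieldType) (d e : nat) (A : 'M[F]_(d, e))
    (r : 'rV[F]_e) :
  r != 0 -> (r <= A)%MS -> (\rank (A *m cokermx r) < \rank A)%N.
Proof.
move=> r0 rA; rewrite -(mxrank_mul_ker A (cokermx r)).
rewrite -[ltnLHS]addn0 ltn_add2l.
have r_sub : (r <= A :&: kermx (cokermx r))%MS.
  by rewrite sub_capmx rA; apply/sub_kermxP; exact: mulmx_coker.
by apply: leq_trans (mxrankS r_sub); rewrite lt0n mxrank_eq0.
Qed.

(** * Merging the fibers along recession directions *)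

(** The variables [w] are only recorded through [w *m A]: for [A = 1] these are
    the pieces with a fixed value of the last [d] coordinates, and a smaller rank
    of [A] means that more of the integer variables have become continuous. *)
Definition fiber (R : realType) (n p d e : nat) (M : set 'rV[R]_(n + p + d))
    (A : 'M[R]_(d, e)) (u : 'rV[R]_e) : set 'rV[R]_n :=
  [set x | exists (y : 'rV[R]_p) (w : 'rV[R]_d),
    M (row_mx (row_mx x y) w) /\ w *m A = u].

Lemma fiber_combination (R : realType) (n p d e : nat)
    (M : set 'rV[R]_(n + p + d)) (A : 'M[R]_(d, e)) (u v : 'rV[R]_e)
    (x x' : 'rV[R]_n) (t : R) :
  convex_set M -> 0 <= t -> t <= 1 -> fiber M A u x -> fiber M A v x' ->
  fiber M A (t *: u + (1 - t) *: v) (t *: x + (1 - t) *: x').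
Proof.
move=> /convex_setP Mconv t0 t1 [y [w [Mw <-]]] [y' [w' [Mw' <-]]].
exists (t *: y + (1 - t) *: y'), (t *: w + (1 - t) *: w'); split.
  by rewrite -!add_row_mx -!scale_row_mx; exact: Mconv.
by rewrite mulmxDl !scalemxAl.
Qed.

Lemma convex_fiber (R : realType) (n p d e : nat)
    (M : set 'rV[R]_(n + p + d)) (A : 'M[R]_(d, e)) (u : 'rV[R]_e) :
  convex_set M -> convex_set (fiber M A u).
Proof.
move=> Mconv; apply/convex_setP => x x' t t0 t1 ux ux'.
have := fiber_combination Mconv t0 t1 ux ux'.
by rewrite -scalerDl addrC subrK scale1r.
Qed.

(** A point of [fiber M A u] moves by a factor t / s only towards a point of
    [fiber M A (u + s *: r) `&` S] when it is combined with it so as to reach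
    [u + t *: r]. As [S] is bounded and [s] can be taken arbitrarily large, the
    displacement is arbitrarily small. *)
Lemma fiber_sub_closure_shift (R : realType) (n p d e : nat)
    (M : set 'rV[R]_(n + p + d)) (S : set 'rV[R]_n) (A : 'M[R]_(d, e))
    (u r : 'rV[R]_e) (t : R) :
  convex_set M -> bounded_set S -> 0 <= t ->
  (forall s0, exists2 s, s0 <= s & fiber M A (u + s *: r) `&` S !=set0) ->
  fiber M A u `<=` closure (fiber M A (u + t *: r)).
Proof.
move=> Mconv /ex_strict_bound_gt0[B B0 SB] t0 far x ux.
move=> V /nbhs_ballP[eps /= eps0 epsV].
(* The threshold ensures t <= s, 0 < s and (t / s) (|x| + B) < eps. *)
have [s s_ge [x' [ux' Sx']]] := far (t + 1 + t * (`|x| + B) / eps).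
have q0 : 0 <= t * (`|x| + B) / eps.
  by rewrite divr_ge0 ?mulr_ge0 ?addr_ge0 ?(ltW B0) ?(ltW eps0).
have s0 : 0 < s by lra.
exists ((t / s) *: x' + (1 - t / s) *: x); split.
  rewrite (_ : u + t *: r = (t / s) *: (u + s *: r) + (1 - t / s) *: u).
    apply: fiber_combination => //; first by rewrite divr_ge0// ltW.
    by rewrite ler_pdivrMr// mul1r; lra.
  rewrite scalerDr scalerA divfK ?gt_eqF// addrAC -scalerDl addrC.
  by rewrite [_ + (1 - _)]addrC subrK scale1r addrC.
apply: epsV; rewrite -ball_normE /=.
rewrite (_ : x - _ = (t / s) *: (x - x')); last first.
  by rewrite scalerBl scale1r addrCA opprD addrA subrr add0r opprB scalerBr.
have xx' : `|x - x'| <= `|x| + B.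
  by rewrite (le_trans (ler_normB _ _))// lerD2l ltW// SB.
rewrite normrZ ger0_norm ?divr_ge0 ?(ltW s0)// mulrAC ltr_pdivrMr//.
apply: le_lt_trans (ler_wpM2l t0 xx') _.
rewrite -ltr_pdivrMl// mulrC; lra.
Qed.

(** Induction on the rank of [A]. If the image of the index set under [A] is
    bounded, it meets the lattice of the [z *m A] in finitely many points.
    Otherwise it has a nonzero integral recession direction [r']. Some multiple
    [N *: r'] is the image of an integral [r], so translation by it permutes the
    lattice; then [fiber_sub_closure_shift] puts every fiber over the lines in
    direction [r'] through lattice points inside the closed set [S]. Hence [A]
    may be replaced by its composition with the projection along [r'], whose
    rank is smaller. *)
Lemma finite_union_of_lattice_fibers (R : realType) (n p d e : nat)
    (M : set 'rV[R]_(n + p + d)) (S : set 'rV[R]_n) (A : 'M[rat]_(d, e)) :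
  convex_set M -> rationally_unbounded (proj_z M) -> compact S ->
  S = \bigcup_(z in @integral_points R d)
        fiber M (map_mx ratr A) (z *m map_mx ratr A) ->
  finite_union_compact_convex S.
Proof.
move=> Mconv Irat Scompact.
have Sclosed : closed S by apply: compact_closed => //; exact: norm_hausdorff.
have [k] := ubnP (\rank A); elim: k A => // k IH A /ltnSE rankA.
set AR := map_mx ratr A => SE.
have in_S z w x y : integral_points z -> w *m AR = z *m AR ->
    M (row_mx (row_mx x y) w) -> S x.
  by move=> zint wz Mw; rewrite SE; exists z => //; exists y, w.
have [[x0]|/nonemptyPn ->] := pselect (S !=set0); last first.
  exists 0, (fun=> set0); split; first by move=> [].
  by apply/seteqP; split=> // x [[]].
rewrite {1}SE => -[z0 z0int [y0 [w0 [Mw0 w0z0]]]].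
have imE : rational_affine A 0 = (fun w : 'rV[R]_d => w *m AR).
  by apply/funext => w; rewrite /rational_affine raddf0 addr0.
have [/=|[r' [r'int]]] := Irat e A 0; rewrite imE.
  move=> IAbounded.
  pose lattice := [set z *m AR | z in @integral_points R d].
  apply: (finite_union_compact_convex_closure
    (F := lattice `&` [set w *m AR | w in proj_z M]) (T := fiber M AR)) => //.
  - exact: finite_bounded_rational_lattice.
  - by move=> u; exact: convex_fiber.
  - rewrite SE; apply/seteqP; split=> x.
      move=> [z zint [y [w [Mw wz]]]]; exists (z *m AR); last by exists y, w.
      split; first by exists z.
      by exists w => //; exists (row_mx (row_mx x y) w); rewrite // row_mxKr.
    by move=> [_ [[z zint <-] _] zx]; exists z.
move=> [r'rec /eqP r'0].
(* r' is a difference of two points of the image, hence in the row space; being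
   rational, it then has rational coordinates there. *)
have r'E : (r' <= AR)%MS.
  have [|w1 _ w1E] := r'rec (w0 *m AR) 1 _ ler01.
    by exists w0 => //; exists (row_mx (row_mx x0 y0) w0); rewrite // row_mxKr.
  have -> : r' = (w1 - w0) *m AR.
    by rewrite mulmxBl w1E scale1r addrAC subrr add0r.
  exact: submxMl.
have [r'q r'qE] := integral_is_ratr r'int.
move: r'E; rewrite r'qE map_submx => /submxP[rq r'qA].
have [N N0 Nrq] := mx_common_denominator rq.
pose r : 'rV[R]_d := map_mx ratr (N%:R *: rq).
have rint : integral_points r by exact: integral_ratr.
have rA : r *m AR = N%:R *: r'.
  by rewrite /r r'qE -map_mxM -scalemxAl -r'qA map_mxZ rmorph_nat.
apply: (IH (A *m cokermx r'q)).
  apply: leq_trans rankA; apply: mxrank_mul_cokermx_lt.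
    by apply: contra_neq r'0 => r'q0; rewrite r'qE r'q0 raddf0.
  by rewrite r'qA submxMl.
rewrite map_mxM map_cokermx -r'qE; apply/seteqP; split=> x.
  rewrite {1}SE => -[z zint [y [w [Mw wz]]]]; exists z => //.
  by exists y, w; split=> //; rewrite !mulmxA wz.
move=> [z zint [y [w [Mw wz]]]].
(* Here w *m AR is on the line through z *m AR, but possibly off the lattice;
   the shifts by m N - a bring it back. *)
have /sub_rVP[a wza] : ((w - z) *m AR <= r')%MS.
  by rewrite submxE -mulmxA mulmxBl wz subrr.
have shift m : w *m AR + (m%:R * N%:R - a) *: r' = (z + m%:R *: r) *m AR.
  rewrite mulmxDl -scalemxAl rA scalerA scalerBl addrCA -wza mulmxBl.
  by rewrite subKr addrC.
have shift_int m : integral_points (z + m%:R *: r).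
  apply/mxOverP => i j; rewrite mxE rpredD ?(mxOverP zint)//.
  by rewrite mxE rpredM ?natr_int ?(mxOverP rint).
pose m_ (s0 : R) := Num.bound (`|s0| + `|a|).
have m_ge s0 : `|s0| + `|a| <= (m_ s0)%:R * N%:R.
  have := archi_boundP (addr_ge0 (normr_ge0 s0) (normr_ge0 a)).
  move=> /ltW /le_trans; apply; rewrite ler_peMr ?ler0n//.
  by rewrite ler1n.
apply: Sclosed; pose t := (m_ 0)%:R * N%:R - a.
apply: (closureS (A := fiber M AR (w *m AR + t *: r'))).
  move=> x1 [y1 [w1 [Mw1 w1E]]]; apply: in_S Mw1; last by rewrite w1E shift.
  exact: shift_int.
apply: (fiber_sub_closure_shift (S := S)) => //; last by exists y, w.
- exact: compact_bounded.
- by rewrite subr_ge0 (le_trans _ (m_ge 0))// normr0 add0r ler_norm.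
move=> s0; have := m_ge s0; set m := m_ s0 => mN.
have s_ge : `|s0| <= m%:R * N%:R - a.
  by have := ler_norm a; lra.
exists (m%:R * N%:R - a); first exact: le_trans (ler_norm _) s_ge.
have [||w1 [v Mv vw1] w1E] := r'rec (w *m AR) (m%:R * N%:R - a).
- by exists w => //; exists (row_mx (row_mx x y) w); rewrite // row_mxKr.
- exact: le_trans s_ge.
have Mv' : M (row_mx (row_mx (lsubmx (lsubmx v)) (rsubmx (lsubmx v))) w1).
  by rewrite -vw1 !hsubmxK.
exists (lsubmx (lsubmx v)); split; first by exists (rsubmx (lsubmx v)), w1.
by apply: in_S Mv'; [exact: shift_int | rewrite w1E shift].
Qed.

(** * The Cayley hull of finitely many compact convex sets *)

Definition rows_in (R : realType) (n k : nat) (C : 'I_k -> set 'rV[R]_n) :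
    set 'M[R]_(k, n) :=
  [set c | forall i, C i (row i c)].

Lemma compact_rows_in (R : realType) (n k : nat) (C : 'I_k -> set 'rV[R]_n) :
  (forall i, compact (C i)) -> compact (rows_in C).
Proof.
move=> Ccompact.
pose of_rows (f : prod_topology (fun _ : 'I_k => 'rV[R]_n)) : 'M[R]_(k, n) :=
  \matrix_i f i.
have -> : rows_in C = of_rows @` [set f | forall i, C i (f i)].
  apply/seteqP; split=> [c cC | _ [f fC <-] i]; last by rewrite rowK.
  by exists (fun i => row i c) => //; apply/row_matrixP => i; rewrite rowK.
apply: (@continuous_compact (prod_topology _) _ of_rows); last exact: tychonoff.
apply: continuous_subspaceT; apply: mx_continuous => i j.
have -> : (fun f => of_rows f i j) = (fun v : 'rV[R]_n => v 0 j) \o proj i.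
  by apply/funext => f; rewrite /= mxE.
move=> f; apply: continuous_comp; first exact: proj_continuous.
exact: coord_continuous.
Qed.

Definition simplex (R : realType) (k : nat) : set 'rV[R]_k :=
  [set z | (forall i, 0 <= z 0 i) /\ \sum_i z 0 i = 1].

Lemma simplex_le1 (R : realType) (k : nat) (z : 'rV[R]_k) i :
  simplex z -> z 0 i <= 1.
Proof.
by move=> [z0 <-]; rewrite (bigD1 i)//= lerDl sumr_ge0.
Qed.

Lemma compact_simplex (R : realType) (k : nat) : compact (@simplex R k).
Proof.
pose cube := [set z : 'rV[R]_k | forall i, `[0, 1]%classic (z 0 i)].
have -> : @simplex R k =
    cube `&` (fun z : 'rV[R]_k => z *m const_mx 1) @^-1` [set (1%:M : 'M[R]_1)].
  have sumE (z : 'rV[R]_k) : z *m const_mx 1 = (\sum_i z 0 i)%:M.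
    apply/matrixP => i j; rewrite !ord1 !mxE eqxx mulr1n.
    by apply: eq_bigr => l _; rewrite mxE mulr1.
  apply/seteqP; split=> z.
    move=> zs; split=> [i|]; last by rewrite /= sumE zs.2.
    by rewrite /= in_itv /= zs.1 simplex_le1.
  move=> [zc] /=; rewrite sumE => /matrixP /(_ 0 0); rewrite !mxE eqxx.
  by split=> // i; have := zc i; rewrite /= in_itv /= => /andP[].
apply: compact_closedI.
  exact: (@rV_compact R k (fun=> `[0, 1]%classic)
                      (fun=> @segment_compact R 0 1)).
apply: preimage_closed.
  move=> z _; apply: (@mulmx_continuous _ _ _ _ _ id (fun=> const_mx 1)) => w.
    exact: cvg_id.
  exact: cst_continuous.
by apply: compact_closed; [exact: norm_hausdorff | exact: compact_set1].
Qed.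

(** A nonzero integral weight is at least 1, which exhausts the total weight. *)
Lemma simplex_integral (R : realType) (k : nat) (z : 'rV[R]_k) :
  simplex z -> integral_points z -> exists i, z = delta_mx 0 i.
Proof.
move=> zs /mxOverP zint.
have [i zi0] : exists i, z 0 i != 0.
  apply/existsP; apply: contraT => /existsPn z0.
  have := zs.2; rewrite big1 => [/esym/eqP|i _]; first by rewrite oner_eq0.
  by apply/eqP; have := z0 i; rewrite negbK.
have zi1 : z 0 i = 1.
  apply/eqP; rewrite eq_le simplex_le1//=.
  have /intrP[m zm] := zint 0 i.
  have := zs.1 i; rewrite zm in zi0 *; rewrite ler0z ler1z.
  by move: zi0; rewrite intr_eq0; lia.
exists i; apply/rowP => j; rewrite mxE eqxx /=.
have [->//|ji] := eqVneq j i.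
move: zs.2 => /eqP; rewrite (bigD1 i)//= zi1 addrC -subr_eq0 addrK.
rewrite psumr_eq0 => [/allP/(_ j)|l _]; last exact: zs.1.
by rewrite mem_index_enum ji => /(_ isT)/eqP ->.
Qed.

(** For nonempty convex sets [C i], this is the convex hull of the union of the
    sets [C i] x {e_i}, with e_i the unit vectors: the rows of [zc.2] are chosen points of the [C i], and [zc.1] is the
    vector of their weights. The middle block is the empty vector of continuous
    variables. *)
Definition cayley_hull (R : realType) (n k : nat) (C : 'I_k -> set 'rV[R]_n) :
    set 'rV[R]_(n + 0 + k) :=
  (fun zc : 'rV[R]_k * 'M[R]_(k, n) =>
    row_mx (row_mx (zc.1 *m zc.2) (0 : 'rV_0)) zc.1) @`
  (@simplex R k `*` rows_in C).

(** A continuous image of the product of the simplex and the sets [C i]. *)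
Lemma compact_cayley_hull (R : realType) (n k : nat)
    (C : 'I_k -> set 'rV[R]_n) :
  (forall i, compact (C i)) -> compact (cayley_hull C).
Proof.
move=> Ccompact; apply: continuous_compact; last first.
  by apply: compact_setX; [exact: compact_simplex | exact: compact_rows_in].
apply: continuous_subspaceT; apply: row_mx_continuous; last first.
  by move=> zc; exact: cvg_fst.
apply: row_mx_continuous; last exact: cst_continuous.
by apply: mulmx_continuous => zc; [exact: cvg_fst | exact: cvg_snd].
Qed.

(** Weights combine linearly to [w], but the chosen points have to be combined
    with the renormalized weights [q i] = t z_i / w_i, so that each one stays in
    its convex set [C i]. *)
Lemma convex_cayley_hull (R : realType) (n k : nat)
    (C : 'I_k -> set 'rV[R]_n) :
  (forall i, convex_set (C i)) -> convex_set (cayley_hull C).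
Proof.
move=> Cconv; apply/convex_setP => u v t t0 t1.
move=> [[z c] /= [zs cC] <-] [[z' c'] /= [z's c'C] <-].
have ge0 i : 0 <= t * z 0 i by rewrite mulr_ge0// zs.1.
have ge0' i : 0 <= (1 - t) * z' 0 i by rewrite mulr_ge0 ?subr_ge0// z's.1.
pose w : 'rV[R]_k := t *: z + (1 - t) *: z'.
have wE i : w 0 i = t * z 0 i + (1 - t) * z' 0 i by rewrite !mxE.
pose q i := t * z 0 i / w 0 i.
pose b : 'M[R]_(k, n) :=
  \matrix_i (q i *: row i c + (1 - q i) *: row i c').
exists (w, b).
  split=> /=; [split=> [i|]|move=> i].
  - by rewrite wE addr_ge0.
  - under eq_bigr do rewrite wE.
    by rewrite big_split /= -!mulr_sumr zs.2 z's.2 !mulr1 addrC subrK.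
  - rewrite rowK; apply: (convex_setP _).1 => //.
      by rewrite divr_ge0// wE addr_ge0.
    have [w0|w0] := eqVneq (w 0 i) 0; first by rewrite /q w0 invr0 mulr0.
    rewrite ler_pdivrMr ?mul1r ?wE ?lerDl// -wE lt_neqAle eq_sym w0 wE.
    by rewrite addr_ge0.
rewrite /= -/w !scale_row_mx !add_row_mx !scaler0 addr0.
congr (row_mx (row_mx _ _) _).
rewrite !mulmx_sum_row !scaler_sumr -big_split /=; apply: eq_bigr => i _.
rewrite rowK scalerDr !scalerA.
(* If w_i = 0 then q_i = 0 by the convention on inverses, and t z_i = 0 as a
   nonnegative summand of w_i. *)
have wq : w 0 i * q i = t * z 0 i.
  rewrite mulrC /q; have [w0|w0] := eqVneq (w 0 i) 0; last by rewrite divfK.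
  rewrite w0 mulr0; apply/esym/eqP.
  by move/eqP: w0; rewrite wE paddr_eq0// => /andP[].
by rewrite mulrBr mulr1 wq wE [X in _ + X *: _]addrAC subrr add0r.
Qed.

(** An integral point of the simplex is a unit vector e_i, and over e_i the hull
    is exactly [C i]. *)
Lemma cayley_hull_formulation (R : realType) (n k : nat)
    (C : 'I_k -> set 'rV[R]_n) :
  (forall i, compact (C i)) -> (forall i, convex_set (C i)) ->
  (forall i, C i !=set0) ->
  binary_formulation (cayley_hull C) (\bigcup_i C i).
Proof.
move=> Ccompact Cconv C0; split.
  split; [|exact: convex_cayley_hull|move=> x; split].
  - apply: compact_closed; first exact: norm_hausdorff.
    exact: compact_cayley_hull.
  - move=> [i _ Cx]; exists 0, (delta_mx 0 i); split.
      by apply/mxOverP => a j; rewrite mxE natr_int.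
    (* The rows of weight zero are arbitrary points of their sets. *)
    pose c : 'M[R]_(k, n) :=
      \matrix_j (if j == i then x else sval (cid (C0 j))).
    exists (delta_mx 0 i, c); last by rewrite /= -rowE rowK eqxx.
    split=> /=; [split=> [j|]|move=> j].
    + by rewrite mxE ler0n.
    + rewrite (bigD1 i)//= mxE !eqxx big1 ?addr0// => j ji.
      by rewrite mxE (negbTE ji) andbF.
    + by rewrite rowK; case: eqP => [->//|_]; case: (cid _).
  - move=> [y [z [zint [[z' c] /= [zs cC] /eq_row_mx[/eq_row_mx[xE _] zE]]]]].
    subst z'; have [i zi] := simplex_integral zs zint.
    by exists i => //; rewrite -xE zi -rowE.
move=> _ [_ [[[z c] /= [zs _] <-] +] <-]; rewrite /= row_mxKr => zint j.
have [i ->] := simplex_integral zs zint.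
by rewrite mxE; case: (j == i); [right | left].
Qed.

Lemma compact_binary_formulation (R : realType) (n : nat) (S : set 'rV[R]_n) :
  finite_union_compact_convex S ->
  exists (d : nat) (M : set 'rV[R]_(n + 0 + d)),
    compact M /\ binary_formulation M S.
Proof.
move=> [k [C [CC ->]]].
have [[i0 Ci0]|noC] := pselect (exists i, C i !=set0); last first.
  have C0 : forall i, C i = set0.
    by move=> i; apply/nonemptyPn => Ci; apply: noC; exists i.
  exists 0, set0; split; first exact: compact0.
  split; last by move=> _ [v [[]]].
  split; [exact: closed0|by move=> x y t; rewrite !inE|move=> x; split].
    by move=> [i _ Cx]; rewrite C0 in Cx.
  by move=> [y [z [_ []]]].
(* The hull needs a point of every set, so the empty sets are replaced by a
   nonempty one. *)
pose D i := if pselect (C i !=set0) then C i else C i0.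
have -> : \bigcup_i C i = \bigcup_i D i.
  apply/seteqP; split=> x [i _ Cx].
    by exists i => //; rewrite /D; case: pselect => //= -[]; exists x.
  by move: Cx; rewrite /D; case: pselect => /= _ Cx; [exists i | exists i0].
have DD i : [/\ compact (D i), convex_set (D i) & D i !=set0].
  have [] := CC i; have [] := CC i0.
  by rewrite /D; case: pselect => // Ci; split.
exists k, (cayley_hull D); split.
  by apply: compact_cayley_hull => i; have [] := DD i.
by apply: cayley_hull_formulation => i; have [] := DD i.
Qed.

(** * The equivalences *)

Lemma compact_rationally_unbounded (R : realType) (m d : nat)
    (M : set 'rV[R]_(m + d)) :
  compact M -> rationally_unbounded (proj_z M).
Proof.
move=> Mcompact e A b; left; apply: compact_bounded.
rewrite image_comp; apply: continuous_compact => //.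
apply: continuous_subspaceT => v.
have rsub_cont : continuous (@rsubmx R 1 m d).
  apply: mx_continuous => i j; under eq_fun do rewrite mxE.
  exact: coord_continuous.
pose AR : 'M[R]_(d, e) := map_mx ratr A; pose bR : 'rV[R]_e := map_mx ratr b.
exact: (cvgD (mulmx_continuous rsub_cont (cst_continuous (x := AR)) (x := v))
             (cvg_cst bR)).
Qed.

Lemma binary_finite_union (R : realType) (n : nat) (S : set 'rV[R]_n) :
  compact S -> binary_MICPR S -> finite_union_compact_convex S.
Proof.
move=> Scompact [p [d [M [[_ Mconv SE] Mbin]]]].
apply: (finite_union_compact_convex_closure
  (F := @integral_points R d `&` [set z | forall j, `|z 0 j| <= 1])
  (T := fiber M 1%:M)) => //.
- exact: finite_bounded_integral_points.
- by move=> z; exact: convex_fiber.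
apply/seteqP; split=> x.
  move=> /SE[y [z [zint Mz]]]; exists z; last by exists y, z; rewrite mulmx1.
  have zbin : binary_points z.
    by apply: Mbin; exists (row_mx (row_mx x y) z); rewrite /= row_mxKr.
  by split=> // j; have [->|->] := zbin j; rewrite ?normr0 ?normr1.
move=> [z [zint _] [y [w [Mw]]]]; rewrite mulmx1 => wz.
by apply/SE; exists y, z; rewrite -{2}wz.
Qed.

Lemma rational_finite_union (R : realType) (n : nat) (S : set 'rV[R]_n) :
  compact S -> rational_MICPR S -> finite_union_compact_convex S.
Proof.
move=> Scompact [p [d [M [[_ Mconv SE] Irat]]]].
apply: (finite_union_of_lattice_fibers (A := 1%:M) Mconv Irat Scompact).
rewrite map_mx1; apply/seteqP; split=> x.
  move=> /SE[y [z [zint Mz]]]; exists z => //.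
  by exists y, z.
move=> [z zint [y [w [Mw]]]]; rewrite !mulmx1 => wz.
by apply/SE; exists y, z; rewrite -{2}wz.
Qed.

Theorem proposition5p4 (R : realType) (n : nat) (S : set 'rV[R]_n) :
  (0 < n)%N -> compact S ->
  [<-> rational_MICPR S;
       finite_union_compact_convex S;
       pure_binary_MICPR S;
       binary_MICPR S].
Proof.
move=> _ Scompact; tfae.
- exact: rational_finite_union.
- by move=> /compact_binary_formulation[d [M [_ MS]]]; exists d, M.
- by move=> [d [M MS]]; exists 0, d, M.
- move=> /(binary_finite_union Scompact)/compact_binary_formulation.
  move=> [d [M [Mcompact [MS _]]]]; exists 0, d, M; split=> //.
  exact: compact_rationally_unbounded.
Qed.
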